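(* Let $K$ and $\hat M=\operatorname{diag}(\hat M_{11},\dots,\hat M_{nn})$ be the stiffness matrix and the row-sum lumped mass matrix of the (trimmed) B-spline discretization of degrees $\bm p=(p_1,\dots,p_d)$ in dimension $d$ described in the context. Then the largest generalized eigenvalue $\lambda_n(K,\hat M)$ satisfies $$\max_{1\le i\le n}\frac{K_{ii}}{\hat M_{ii}}\;\le\;\lambda_n(K,\hat M)\;\le\; c(\bm p,d)\,\max_{1\le i\le n}\frac{K_{ii}}{\hat M_{ii}},$$ where $c(\bm p,d)\le\prod_{k=1}^d(2p_k+1)$ only depends on the dimension and the spline degree.
   Context: Let $\Omega\subset\mathbb R^d$ be open and connected with Lipschitz boundary $\partial\Omega=\overline{\partial\Omega_D\cup\partial\Omega_N}$, $\partial\Omega_D\cap\partial\Omega_N=\emptyset$, $\partial\Omega_D\ne\emptyset$, embedded in a fictitious domain $\Omega_0\supset\Omega$ with $\partial\Omega_D\subset\partial\Omega_0$. Let $V=\{v\in H^1(\Omega): v|_{\partial\Omega_D}=0\}$. On a background mesh of $\Omega_0$, consider tensor-product B-splines $\varphi_{\bm i}=\varphi_{1,i_1}\cdots\varphi_{d,i_d}$ of degree $p_l\ge1$ in direction $l$, built from open knot vectors (first and last knot repeated $p_l+1$ times) with internal knots of multiplicity between $1$ and $p_l$. These functions are nonnegative, and form a partition of unity before boundary conditions are imposed. The active basis $\Phi=\{\varphi_1,\dots,\varphi_n\}$ consists of those B-splines whose support intersects $\Omega$, with the homogeneous Dirichlet condition on $\partial\Omega_D$ strongly imposed, so that $V_h=\operatorname{span}(\Phi)\subset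 V$. The stiffness matrix is $K=(a(\varphi_i,\varphi_j))_{i,j=1}^n$ with $a(u,v)=\int_\Omega\nabla u\cdot\nabla v$; it is symmetric positive semidefinite. The row-sum lumped mass matrix is the diagonal positive definite matrix $\hat M=\operatorname{diag}(d_1,\dots,d_n)$ whose entries $d_i$ are the row sums of the mass matrix with entries $\int_\Omega\varphi_i\varphi_j$, the sums being taken before elimination of Dirichlet degrees of freedom, so that, by partition of unity, $\hat M_{ii}=d_i=\int_\Omega\varphi_i=\|\varphi_i\|_{L^1(\Omega)}$. The generalized eigenvalues of $(K,\hat M)$ are the $\lambda$ with $K\bm x=\lambda\hat M\bm x$ for some $\bm x\neq0$, ordered as $\lambda_1(K,\hat M)\le\dots\le\lambda_n(K,\hat M)$. *)

(* Defs.v *)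
From HB Require Import structures.
From mathcomp Require Import all_boot all_order all_algebra.
From mathcomp Require Import all_classical all_reals all_analysis.
Import Order.TTheory GRing.Theory Num.Theory numFieldNormedType.Exports.

Set Implicit Arguments.
Unset Strict Implicit.
Unset Printing Implicit Defensive.

Local Open Scope classical_set_scope.
Local Open Scope ring_scope.

Section lebesgue_step.
Context {R : realType} {n : nat}.
Let T := n.-tuple (measurableTypeR R).
Variable mu : {sigma_finite_measure set T -> \bar R}.

Definition tuple_of_pair (z : measurableTypeR R * T) :
  n.+1.-tuple (measurableTypeR R) := [tuple of z.1 :: z.2].

Lemma measurable_tuple_of_pair : measurable_fun [set: _] tuple_of_pair.
Proof. exact: measurable_cons. Qed.

Let leb1 : {sigma_finite_measure set (measurableTypeR R) -> \bar R} :=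
  @lebesgue_measure R.

Definition lebesgue_step : set (n.+1.-tuple (measurableTypeR R)) -> \bar R :=
  pushforward (leb1 \x mu)%E tuple_of_pair.

HB.instance Definition _ := Measure.copy lebesgue_step
  (measure_function_pushforward__canonical__measure_function_Measure
    (leb1 \x mu)%E measurable_tuple_of_pair).

Lemma lebesgue_step_sigma_finite : sigma_finite [set: _] lebesgue_step.
Proof.
have [F FT Ffin] : sigma_finite [set: _] (leb1 \x mu)%E.
  have /sigma_finiteP[A [TA ndA Afin]] := sigma_finiteT leb1.
  have /sigma_finiteP[B [TB ndB Bfin]] := sigma_finiteT mu.
  exists (fun k => A k `*` B k).
    rewrite -setXTT TA TB predeqE => -[x y]; split; last first.
      by move=> [k _ []/= ? ?]; split; exists k.
    move=> [/= [k _ Akx] [l _ Bly]]; exists (maxn k l) => //; split.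
    - by move: x Akx; exact/subsetPset/ndA/leq_maxl.
    - by move: y Bly; exact/subsetPset/ndB/leq_maxr.
  move=> k; have [mA Ak] := Afin k; have [mB Bk] := Bfin k.
  split; first exact: measurableX.
  by rewrite product_measure1E// lte_mul_pinfty// ge0_fin_numE.
pose g (t : n.+1.-tuple (measurableTypeR R)) : measurableTypeR R * T :=
  (thead t, [tuple of behead t]).
have gK : cancel g tuple_of_pair.
  by move=> t; apply/val_inj => /=; rewrite [in RHS](tuple_eta t).
have Kg : cancel tuple_of_pair g.
  by case=> x t; rewrite /g /tuple_of_pair /=; congr pair; apply/val_inj.
have mg : measurable_fun setT g.
  apply/measurable_fun_pairP; split.
    exact: (measurable_tnth ord0).
  exact: measurable_behead.
exists (fun k => g @^-1` F k).
  by rewrite -preimage_bigcup -FT preimage_setT.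
move=> k; have [mF Fk] := Ffin k; split.
  by rewrite -[X in measurable X]setTI; exact: mg.
rewrite /lebesgue_step /pushforward.
suff -> : tuple_of_pair @^-1` (g @^-1` F k) = F k by [].
by apply/seteqP; split => z /=; rewrite Kg.
Qed.

HB.instance Definition _ :=
  Measure_isSigmaFinite.Build _ _ _ lebesgue_step lebesgue_step_sigma_finite.

End lebesgue_step.

(* Lebesgue measure on R^n, as an iterated product measure on n-tuples. *)
Fixpoint lebesgue_tuple (R : realType) (n : nat) :
    {sigma_finite_measure set (n.-tuple (measurableTypeR R)) -> \bar R} :=
  match n with
  | 0 => dirac ([tuple] : 0.-tuple (measurableTypeR R))
  | m.+1 => lebesgue_step (lebesgue_tuple R m)
  end.

Lemma lebesgue_tuple_box (R : realType) (n : nat)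
    (A : 'I_n -> set (measurableTypeR R)) : (forall i, measurable (A i)) ->
  lebesgue_tuple R n [set t | forall i, A i (tnth t i)] =
  (\prod_(i < n) lebesgue_measure (A i))%E.
Proof.
elim: n A => [|n IHn] A mA.
  by rewrite big_ord0 /= diracE mem_set// => -[].
rewrite big_ord_recl -(IHn (fun i => A (lift ord0 i)))//.
rewrite /= /lebesgue_step /pushforward.
rewrite -product_measure1E//; last first.
  rewrite [X in measurable X](_ : _ =
    \big[setI/setT]_(i < n) ((@tnth n (measurableTypeR R)) ^~ i @^-1` A (lift ord0 i))).
    apply: bigsetI_measurable => i _; rewrite -[X in measurable X]setTI.
    exact: measurable_tnth.
  by rewrite -bigcap_seq; apply/seteqP; split => t /= H i; [move=> _|]; apply: H => //=; rewrite mem_index_enum.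
congr (_ _); apply/seteqP; split => -[x t] /=.
  move=> H; split => [|i]; first exact: (H ord0).
  by have := H (lift ord0 i); rewrite tnthS.
by move=> [Hx Ht] i; case: (unliftP ord0 i) => [j|] ->//; rewrite tnthS.
Qed.

Section euclidean.
Context {R : realType} {d : nat}.
Implicit Types (D : set 'rV[R]_d) (u v : 'rV[R]_d -> R).

Definition row_of_tuple (t : d.-tuple (measurableTypeR R)) : 'rV[R]_d :=
  \row_i tnth t i.

Definition integral_over D u : R :=
  \int[lebesgue_tuple R d]_(t in row_of_tuple @^-1` D) u (row_of_tuple t).

Definition partial (l : 'I_d) u (x : 'rV[R]_d) : R :=
  'D_(delta_mx 0 l) u x.

(* The integral over D of the dot product of the gradients. For continuous
   piecewise polynomials the pointwise gradient exists almost everywhere and is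
   the weak gradient. *)
Definition dirichlet_form D u v : R :=
  integral_over D (fun x => \sum_(l < d) partial l u x * partial l v x).

Definition boundary D : set 'rV[R]_d := closure D `\` interior D.

Definition fsupport u : set 'rV[R]_d := closure [set x | u x != 0].

(* Near each boundary point, D is the strict epigraph of a Lipschitz function
   in some orthonormal coordinate system: e is the unit vector of the last
   coordinate, and invariance of g along e says that g only depends on the
   other coordinates. *)
Definition lipschitz_boundary D : Prop :=
  forall x, boundary D x -> exists (e : 'rV[R]_d) (g : 'rV[R]_d -> R),
    [/\ \sum_(l < d) e 0 l ^+ 2 = 1,
        lipschitz g,
        forall y t, g (y + t *: e) = g y &
        \forall y \near x, D y <-> g y < \sum_(l < d) y 0 l * e 0 l].

End euclidean.

Section bsplines.
Context {R : realType}.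
Implicit Types (xi : seq R) (x : R).

Definition open_knot_vector (p : nat) xi : Prop :=
  [/\ sorted <=%R xi,
      head 0 xi < last 0 xi,
      count_mem (head 0 xi) xi = p.+1,
      count_mem (last 0 xi) xi = p.+1 &
      forall x, head 0 xi < x < last 0 xi -> (count_mem x xi <= p)%N].

(* Cox-de Boor recursion. The last nonempty knot span is closed on the right,
   so that the B-splines sum to 1 on the whole closed interval. A term over an
   empty knot span vanishes because 0^-1 = 0. *)
Fixpoint bspline xi (p i : nat) x : R :=
  match p with
  | 0 => ((xi`_i <= x < xi`_i.+1) ||
          [&& xi`_i < xi`_i.+1, xi`_i.+1 == last 0 xi & x == last 0 xi])%:R
  | q.+1 =>
      (x - xi`_i) / (xi`_(i + p) - xi`_i) * bspline xi q i x +
      (xi`_(i + p).+1 - x) / (xi`_(i + p).+1 - xi`_i.+1) * bspline xi q i.+1 x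
  end.

Definition bspline_number (p : nat) xi : nat := (size xi - p.+1)%N.

End bsplines.

Definition knot_box {R : realType} {d : nat} (xi : 'I_d -> seq R) :
    set 'rV[R]_d :=
  [set x | forall l, head 0 (xi l) < x 0 l < last 0 (xi l)].

Record trimmed_discretization (R : realType) (d : nat) (p : 'I_d -> nat) := {
  knots : 'I_d -> seq R;
  domain : set 'rV[R]_d;
  dirichlet_part : set 'rV[R]_d;
  neumann_part : set 'rV[R]_d;
  dimension_gt0 : (0 < d)%N;
  degree_ge1 : forall l, (1 <= p l)%N;
  open_knots : forall l, open_knot_vector (p l) (knots l);
  open_domain : open domain;
  connected_domain : connected domain;
  lipschitz_domain : lipschitz_boundary domain;
  boundary_domain : boundary domain = closure (dirichlet_part `|` neumann_part);
  disjoint_parts : dirichlet_part `&` neumann_part = set0;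
  dirichlet_nonempty : dirichlet_part !=set0;
  domain_sub_box : domain `<=` knot_box knots;
  dirichlet_sub_box : dirichlet_part `<=` boundary (knot_box knots)
}.

Section discretization.
Context {R : realType} {d : nat} {p : 'I_d -> nat}.
Variable X : trimmed_discretization R p.

Definition multi_index : finType :=
  {dffun forall l : 'I_d, 'I_(bspline_number (p l) (knots X l))}.

Definition tensor_bspline (i : multi_index) (x : 'rV[R]_d) : R :=
  \prod_(l < d) bspline (knots X l) (p l) (i l) (x 0 l).

Definition trimmed_basis : {set multi_index} :=
  [set i | `[< fsupport (tensor_bspline i) `&` domain X !=set0 >]]%SET.

(* Strong imposition of the Dirichlet condition: the B-splines that do not
   vanish on the Dirichlet part are removed. *)
Definition active_basis : {set multi_index} :=
  [set i in trimmed_basis |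
    `[< forall x, dirichlet_part X x -> tensor_bspline i x = 0 >]]%SET.

Definition active_bspline (i : 'I_#|active_basis|) : 'rV[R]_d -> R :=
  tensor_bspline (enum_val i).

Definition stiffness : 'M[R]_#|active_basis| :=
  \matrix_(i, j)
    dirichlet_form (domain X) (active_bspline i) (active_bspline j).

(* Each row sum runs over trimmed_basis, not active_basis: it is taken before
   the elimination of the Dirichlet degrees of freedom. *)
Definition lumped_mass : 'M[R]_#|active_basis| :=
  diag_mx (\row_i \sum_(j in trimmed_basis)
    integral_over (domain X)
      (fun x => active_bspline i x * tensor_bspline j x)).

End discretization.

Definition gen_eigenvalue {R : realType} {n : nat} (K M : 'M[R]_n) (lam : R) :
    Prop :=
  exists2 x : 'cV[R]_n, x != 0 & K *m x = lam *: (M *m x).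

Definition largest_gen_eigenvalue {R : realType} {n : nat} (K M : 'M[R]_n)
    (lam : R) : Prop :=
  gen_eigenvalue K M lam /\ forall mu, gen_eigenvalue K M mu -> mu <= lam.

(* The maximum starts from 0, so this is the plain maximum when n > 0 and the
   ratios are nonnegative, as they are for the matrices above. *)
Definition max_diag_ratio {R : realType} {n : nat} (K M : 'M[R]_n) : R :=
  \big[Num.max/0]_(i < n) (K i i / M i i).

(* Main.v *)
(** Write M for the lumped mass matrix, which is diagonal with positive entries.
    The largest generalized eigenvalue is the maximum of the Rayleigh quotient
    x^T K x / x^T M x, so the coordinate vectors give the lower bound.  For the
    upper bound, K_ij = 0 unless the supports of the two B-splines overlap, which
    for a given i happens for at most prod_k (2 p_k + 1) indices j, and the
    Dirichlet form satisfies 2 x_i x_j K_ij <= x_i^2 K_ii + x_j^2 K_jj.  Summing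
    over overlapping pairs gives x^T K x <= c sum_i K_ii x_i^2, and
    K_ii <= M_ii max_j (K_jj / M_jj) concludes. *)

Require Import Defs.
From mathcomp Require Import all_boot all_order all_algebra.
From mathcomp Require Import all_classical all_reals all_analysis.
From mathcomp Require Import measurable_realfun zify ring lra.
Import Order.TTheory GRing.Theory Num.Theory numFieldNormedType.Exports.

Local Open Scope classical_set_scope.
Local Open Scope ring_scope.

Set Implicit Arguments.
Unset Strict Implicit.
Unset Printing Implicit Defensive.

(** * Quadratic forms and generalized eigenvalues *)

Section quadratic_forms.
Context {R : realType} {n : nat}.
Implicit Types (K : 'M[R]_n) (m x y : 'rV[R]_n).

Definition quadratic_form K x : R :=
  \sum_(i < n) \sum_(j < n) K i j * (x 0 i * x 0 j).

Lemma quadratic_formE K x : quadratic_form K x = (x *m K *m x^T) 0 0.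
Proof.
rewrite mxE /quadratic_form exchange_big /=; apply: eq_bigr => j _.
rewrite !mxE mulr_suml; apply: eq_bigr => i _.
by rewrite mulrCA mulrA.
Qed.

Lemma quadratic_form_diag m x :
  quadratic_form (diag_mx m) x = \sum_(i < n) m 0 i * x 0 i ^+ 2.
Proof.
apply: eq_bigr => i _; rewrite (bigD1 i)//= big1 ?addr0.
  by rewrite mxE eqxx mulr1n expr2.
by move=> j /negPf ji; rewrite mxE eq_sym ji mul0r.
Qed.

Lemma quadratic_formZ K (a : R) x :
  quadratic_form K (a *: x) = a ^+ 2 * quadratic_form K x.
Proof.
rewrite mulr_sumr; apply: eq_bigr => i _; rewrite mulr_sumr.
by apply: eq_bigr => j _; rewrite !mxE; ring.
Qed.

Lemma quadratic_form0 K : quadratic_form K 0 = 0.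
Proof. by rewrite quadratic_formE !mul0mx mxE. Qed.

Lemma continuous_quadratic_form K : continuous (quadratic_form K).
Proof.
have ? x : Filter (nbhs (x : 'rV[R]_n)) by exact: nbhs_filter.
move=> x; apply: cvg_big => [|i _]; first exact: add_continuous.
apply: cvg_big => [|j _]; first exact: add_continuous.
apply: cvgM; first exact: cvg_cst.
by apply: cvgM; exact: coord_continuous.
Qed.

Lemma quadratic_form_delta K (i : 'I_n) :
  quadratic_form K (delta_mx 0 i) = K i i.
Proof.
rewrite /quadratic_form (bigD1 i)//= [X in _ + X]big1 ?addr0; last first.
  by move=> j /negPf ji; apply: big1 => k _; rewrite !mxE ji andbF mul0r mulr0.
rewrite (bigD1 i)//= big1 ?addr0; last first.
  by move=> j /negPf ji; rewrite !mxE ji andbF !mulr0.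
by rewrite !mxE !eqxx !mulr1.
Qed.

(** Perturb [x] in the direction [r = x *m K]: the form becomes [t ^+ 2 * A + 2 * t * B] with [B]
    the squared length of [r]. If [B] were positive, the linear term would make the form negative
    for a small negative [t]. *)
Lemma isotropic_psd_kernel K x : K^T = K ->
  (forall y, 0 <= quadratic_form K y) -> quadratic_form K x = 0 ->
  K *m x^T = 0.
Proof.
move=> Ksym Kpos Kx; have [r rdef] : exists r, r = x *m K by exists (x *m K).
have rE : K *m x^T = r^T by rewrite rdef trmx_mul Ksym.
suff r0 : r = 0 by rewrite rE r0 trmx0.
pose B := \sum_(i < n) r 0 i ^+ 2.
have BE : (r *m r^T) 0 0 = B.
  by rewrite mxE; apply: eq_bigr => i _; rewrite mxE expr2.
pose A := quadratic_form K r.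
have expand t : quadratic_form K (x + t *: r) = t ^+ 2 * A + 2 * t * B.
  have addE (P Q : 'M[R]_1) : (P + Q) 0 0 = P 0 0 + Q 0 0 by rewrite mxE.
  have scaleE c (P : 'M[R]_1) : (c *: P) 0 0 = c * P 0 0 by rewrite mxE.
  rewrite /A !quadratic_formE in Kx *.
  have E : r *m K *m x^T = r *m r^T by rewrite -mulmxA rE.
  rewrite linearD/= linearZ/= !mulmxDl !mulmxDr -!scalemxAl -!scalemxAr.
  rewrite E -rdef !addE !scaleE BE rdef Kx.
  by ring.
have A0 : 0 <= A by exact: Kpos.
have B0 : 0 <= B by apply: sumr_ge0 => i _; exact: sqr_ge0.
have B00 : B = 0.
  apply/eqP; rewrite eq_le B0 andbT leNgt; apply/negP => Bgt.
  have A1 : 0 < A + 1 by lra.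
  (* The minimizer would be [t = - B / A]; using [A + 1] keeps the denominator positive when
     [A = 0], and the value is still negative. *)
  have := Kpos (x + (- (B / (A + 1))) *: r); rewrite expand.
  have -> : (- (B / (A + 1))) ^+ 2 * A + 2 * - (B / (A + 1)) * B =
    - (B / (A + 1)) ^+ 2 * (A + 2).
    by field; rewrite gt_eqF.
  have H : 0 < (B / (A + 1)) ^+ 2 by rewrite exprn_gt0// divr_gt0.
  by nra.
apply/rowP => i; rewrite [RHS]mxE; apply/eqP; rewrite -sqrf_eq0; apply/eqP.
by apply: (psumr_eq0P _ B00) => // j _; exact: sqr_ge0.
Qed.

Lemma ellipsoid_compact m : (forall i, 0 < m 0 i) ->
  compact [set x | quadratic_form (diag_mx m) x = 1].
Proof.
move=> m0; apply: bounded_closed_compact; last first.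
  apply: (@preimage_closed _ _ (quadratic_form (diag_mx m)) [set 1]%classic).
    by move=> x _; exact: continuous_quadratic_form.
  exact: closed_eq.
(* The summand 1 forces any bound [N] above [M] to exceed 1, so that a squared coordinate at most
   [N] is also at most [N ^+ 2]. *)
pose M := 1 + \sum_(i < n) (m 0 i)^-1.
have ge0 i : true -> 0 <= (m 0 i)^-1 by rewrite invr_ge0 ltW.
have M1 : 1 <= M by rewrite lerDl sumr_ge0.
exists M; split; first exact: num_real.
move=> N MN x /= qx.
have N0 : 0 <= N by lra.
rewrite [`|x|]/Num.norm/= mx_normrE.
apply/bigmax_leP; split => // -[i j] _ /=; rewrite (ord1 i).
have xj : x 0 j ^+ 2 <= (m 0 j)^-1.
  rewrite -[leRHS]mulr1 mulrC ler_pdivlMr// mulrC -qx quadratic_form_diag.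
  rewrite (bigD1 j)//= lerDl sumr_ge0// => k _.
  by rewrite mulr_ge0 ?sqr_ge0// ltW.
have mjM : (m 0 j)^-1 <= N.
  apply: le_trans (ltW MN); rewrite /M (bigD1 j)//= addrCA lerDl.
  by rewrite addr_ge0// sumr_ge0// => k _; exact: ge0.
rewrite -(@ler_pXn2r _ 2)// ?nnegrE// real_normK ?num_real//.
by nra.
Qed.

Lemma quadratic_form_diag_gt0 m x : (forall i, 0 < m 0 i) -> x != 0 ->
  0 < quadratic_form (diag_mx m) x.
Proof.
move=> m0 x0; have ge0 i : true -> 0 <= m 0 i * x 0 i ^+ 2.
  by move=> _; rewrite mulr_ge0 ?sqr_ge0// ltW.
rewrite quadratic_form_diag lt_def sumr_ge0// andbT.
apply: contra x0 => /eqP qx0; apply/eqP/rowP => i; rewrite [RHS]mxE.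
have /eqP := psumr_eq0P ge0 qx0 (erefl : xpredT i).
by rewrite mulf_eq0 (gt_eqF (m0 i))/= sqrf_eq0 => /eqP.
Qed.

(** The eigenvalue is the maximum of the form of [K] on the compact ellipsoid where the form of [M]
    equals 1, which is nonempty since [0 < n]. Homogeneity turns this maximum into the Rayleigh
    bound, which dominates every other eigenvalue. *)
Lemma largest_gen_eigenvalue_diag K m : (0 < n)%N -> K^T = K ->
  (forall i, 0 < m 0 i) ->
  exists2 lam, largest_gen_eigenvalue K (diag_mx m) lam &
    forall x, quadratic_form K x <= lam * quadratic_form (diag_mx m) x.
Proof.
move=> n0 Ksym m0; set M := diag_mx m.
have M_gt0 x : x != 0 -> 0 < quadratic_form M x.
  exact: quadratic_form_diag_gt0.
have M_ge0 x : 0 <= quadratic_form M x.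
  have [->|/M_gt0/ltW//] := eqVneq x 0; by rewrite quadratic_form0.
pose S := [set x | quadratic_form M x = 1]%classic.
have normalize x : x != 0 ->
    quadratic_form M ((Num.sqrt (quadratic_form M x))^-1 *: x) = 1.
  move=> x0; rewrite quadratic_formZ exprVn sqr_sqrtr//.
  by rewrite mulVf// gt_eqF// M_gt0.
have S0 : (S !=set0)%classic.
  exists ((Num.sqrt (quadratic_form M (delta_mx 0 (Ordinal n0))))^-1
    *: delta_mx 0 (Ordinal n0)).
  apply: normalize; apply/eqP => /rowP/(_ (Ordinal n0)).
  by rewrite !mxE !eqxx => /eqP; rewrite oner_eq0.
have [c /set_mem /= Sc cmax] := EVT_max_rV S0 (ellipsoid_compact m0)
  (continuous_subspaceT (@continuous_quadratic_form K)).
pose lam := quadratic_form K c.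
have lamP x : quadratic_form K x <= lam * quadratic_form M x.
  have [->|x0] := eqVneq x 0.
    by rewrite !quadratic_form0 mulr0.
  rewrite -ler_pdivrMr ?M_gt0//.
  have := cmax _ (mem_set (normalize _ x0)).
  by rewrite quadratic_formZ exprVn sqr_sqrtr// mulrC.
exists lam => //; split; last first.
  move=> mu [x x0 Kx].
  have xT0 : x^T != 0 by rewrite -(inj_eq (@trmx_inj _ _ _)) trmxK trmx0.
  rewrite -(ler_pM2r (M_gt0 _ xT0)); apply: le_trans (lamP x^T).
  by rewrite !quadratic_formE trmxK -!mulmxA Kx -scalemxAr [in leRHS]mxE.
exists c^T.
  rewrite -(inj_eq (@trmx_inj _ _ _)) trmxK trmx0; apply/eqP => c0.
  move: Sc; rewrite /S /= c0 quadratic_form0 => /eqP.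
  by rewrite eq_sym oner_eq0.
have PE x : quadratic_form (lam *: M - K) x =
    lam * quadratic_form M x - quadratic_form K x.
  rewrite !quadratic_formE mulmxBr mulmxBl -scalemxAr -scalemxAl.
  by rewrite [LHS]mxE [X in X + _]mxE [X in _ + X]mxE.
(* Instead of Lagrange multipliers: [lam *: M - K] is positive semidefinite by the Rayleigh bound
   and isotropic at the maximizer [c], so it annihilates [c]. *)
have : (lam *: M - K) *m c^T = 0.
  apply: isotropic_psd_kernel.
  - by rewrite linearB linearZ /= Ksym tr_diag_mx.
  - by move=> y; rewrite PE subr_ge0.
  - by rewrite PE Sc mulr1 subrr.
by rewrite mulmxBl -scalemxAl => /eqP; rewrite subr_eq0 eq_sym => /eqP.
Qed.

(* Each off-diagonal entry is split by AM-GM between its two diagonal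
   entries, so every diagonal entry is used once per neighbour. *)
Lemma quadratic_form_le_diag K (nb : rel 'I_n) (C : nat) x :
  (forall i j (s t : R),
     2 * (s * t) * K i j <= s ^+ 2 * K i i + t ^+ 2 * K j j) ->
  (forall i j, ~~ nb i j -> K i j = 0) ->
  symmetric nb -> (forall i, #|[pred j | nb i j]| <= C)%N ->
  (forall i, 0 <= K i i) ->
  quadratic_form K x <= C%:R * \sum_(i < n) K i i * x 0 i ^+ 2.
Proof.
move=> amgm K0 nb_sym nbC Kpos.
pose f i : R := K i i * x 0 i ^+ 2.
have le1 : quadratic_form K x <=
    \sum_(i < n) \sum_(j < n | nb i j) (f i / 2 + f j / 2).
  apply: ler_sum => i _; rewrite [leRHS]big_mkcond/=; apply: ler_sum => j _.
  have [_|/K0 ->] := boolP (nb i j); last by rewrite mul0r.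
  by have := amgm i j (x 0 i) (x 0 j); rewrite /f; lra.
apply: (le_trans le1).
have swap : \sum_(i < n) \sum_(j < n | nb i j) (f j / 2) =
    \sum_(i < n) \sum_(j < n | nb i j) (f i / 2).
  rewrite (exchange_big_dep predT)//=; apply: eq_bigr => j _.
  by apply: eq_bigl => i; rewrite nb_sym.
under eq_bigr do rewrite big_split/=.
rewrite big_split/= swap -big_split/= mulr_sumr; apply: ler_sum => i _.
rewrite -big_split/= -/(f i).
under eq_bigr do rewrite -splitr.
rewrite sumr_const -[leLHS]mulr_natl ler_wpM2r//.
  by rewrite mulr_ge0 ?sqr_ge0.
by rewrite ler_nat; exact: nbC.
Qed.

End quadratic_forms.

(** * Bounded measurable functions *)

Section bounded_measurable.
Context {R : realType} (d : measure_display) (T : measurableType d).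
Implicit Types (D : set T) (f g : T -> R).

(** Unlike integrability, this property is stable under products, and it implies integrability on
    sets of finite measure. It covers the B-splines, their derivatives and all the integrands built
    from them. *)
Definition bounded_measurable D f : Prop :=
  measurable_fun D f /\ exists M, forall x, D x -> `|f x| <= M.

Lemma bounded_measurable_cst D (a : R) : bounded_measurable D (fun=> a).
Proof. by split=> //; exists `|a|. Qed.

Lemma bounded_measurableD D f g : bounded_measurable D f ->
  bounded_measurable D g -> bounded_measurable D (fun x => f x + g x).
Proof.
move=> [mf [A fA]] [mg [B gB]]; split; first exact: measurable_funD.
by exists (A + B) => x Dx; rewrite (le_trans (ler_normD _ _))// lerD ?fA ?gB.
Qed.

Lemma bounded_measurableN D f :
  bounded_measurable D f -> bounded_measurable D (fun x => - f x).
Proof.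
move=> [mf [A fA]]; split; first exact: measurableT_comp.
by exists A => x Dx; rewrite normrN fA.
Qed.

Lemma bounded_measurableM D f g : bounded_measurable D f ->
  bounded_measurable D g -> bounded_measurable D (fun x => f x * g x).
Proof.
move=> [mf [A fA]] [mg [B gB]]; split; first exact: measurable_funM.
by exists (A * B) => x Dx; rewrite normrM ler_pM ?fA ?gB.
Qed.

Lemma bounded_measurable_sum (I : Type) (r : seq I) (P : pred I) D
    (F : I -> T -> R) : (forall i, P i -> bounded_measurable D (F i)) ->
  bounded_measurable D (fun x => \sum_(i <- r | P i) F i x).
Proof.
move=> FP; elim: r => [|i r IH].
  by under eq_fun do rewrite big_nil; exact: bounded_measurable_cst.
under eq_fun do rewrite big_cons.
by have [Pi|//] := boolP (P i); apply: bounded_measurableD => //; exact: FP.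
Qed.

Lemma bounded_measurable_prod (I : Type) (r : seq I) (P : pred I) D
    (F : I -> T -> R) : (forall i, P i -> bounded_measurable D (F i)) ->
  bounded_measurable D (fun x => \prod_(i <- r | P i) F i x).
Proof.
move=> FP; elim: r => [|i r IH].
  by under eq_fun do rewrite big_nil; exact: bounded_measurable_cst.
under eq_fun do rewrite big_cons.
by have [Pi|//] := boolP (P i); apply: bounded_measurableM => //; exact: FP.
Qed.

Lemma bounded_measurable_integrable
    (mu : {measure set T -> \bar R}) D f : measurable D -> (mu D < +oo)%E ->
  bounded_measurable D f -> mu.-integrable D (EFin \o f).
Proof.
move=> mD muD [mf [M fM]]; apply: measurable_bounded_integrable => //.
exists M; split; first exact: num_real.
by move=> N MN x Dx; apply: (le_trans (fM x Dx)); exact: ltW.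
Qed.

End bounded_measurable.

Lemma bounded_measurable_comp {R : realType} {d1 d2 : measure_display}
    {T1 : measurableType d1} {T2 : measurableType d2} (D : set T1) (E : set T2)
    (f : T2 -> R) (g : T1 -> T2) : measurable E -> (forall x, D x -> E (g x)) ->
  measurable_fun D g -> bounded_measurable E f ->
  bounded_measurable D (fun x => f (g x)).
Proof.
move=> mE gDE mg [mf [M fM]]; split; last by exists M => x /gDE /fM.
by apply: (measurable_comp mE) mf mg => _ [x Dx <-]; exact: gDE.
Qed.

(** Preimages under [f] and [g] differ only inside a finite set, all of whose subsets are
    measurable, and finitely many new values keep the function bounded. This absorbs the values of a
    derivative at the knots. *)
Lemma bounded_measurable_eq_off_seq {R : realType} (D : set R) (s : seq R)
    (f g : R -> R) : measurable D -> bounded_measurable D f ->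
  (forall x, x \notin s -> g x = f x) -> bounded_measurable D g.
Proof.
move=> mD [mf [M fM]] gf; split; last first.
  exists (Num.max M (\big[Num.max/M]_(y <- s) `|g y|)) => x Dx.
  have [xs|/gf ->] := boolP (x \in s); last by rewrite le_max fM.
  by rewrite le_max (le_bigmax_seq M x) ?orbT.
move=> _ Y mY; pose S := [set` s].
have cS A : countable (A `&` S)%classic.
  apply: finite_set_countable; apply: sub_finite_set (finite_seq s).
  exact: subIsetr.
have mS A : measurable (A `&` S)%classic.
  by apply: countable_measurable => //; exact: measurable_set1.
have -> : (D `&` g @^-1` Y =
    ((D `&` f @^-1` Y) `\` (setT `&` S)) `|` ((D `&` g @^-1` Y) `&` S))%classic.
  apply/seteqP; split => x /=.
    move=> [Dx Yx]; have [xs|xs] := boolP (x \in s); [by right|left].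
    by rewrite -(gf _ xs); split => //; case => _; exact/negP.
  move=> [[[Dx Yx] xs]|[]//]; split => //; rewrite gf//.
  by apply/negP => xs'; apply: xs.
by apply: measurableU => //; apply: measurableD => //; exact: mf.
Qed.

Lemma bounded_measurable_id_itv {R : realType} (a b : R) :
  bounded_measurable `]a, b[ (id : R -> R).
Proof.
split; first exact: measurable_id.
exists (`|a| + `|b|) => x /=; rewrite in_itv/= => /andP[ax xb].
have := ler_norm b; have := ler_norm (- a); rewrite normrN.
by have := normr_ge0 a; have := normr_ge0 b; rewrite ler_norml; lra.
Qed.

(** * Univariate B-splines *)

Section bspline_theory.
Context {R : realType}.
Variable xi : seq R.
Hypothesis xi_sorted : sorted <=%R xi.
Implicit Types (p i j : nat) (x y : R).

Lemma knot_le i j : (i <= j < size xi)%N -> xi`_i <= xi`_j.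
Proof.
move=> /andP[ij js]; apply: le_sorted_leq_nth => //; rewrite inE//.
exact: leq_ltn_trans js.
Qed.

(** By induction, the two terms of the recursion live on two knot intervals whose union is contained
    in the claimed one. The bound on [x] excludes the right-closed convention of the last span; the
    bound on the index keeps all knots inside the list. *)
Lemma bspline_support p i x : ((i + p).+1 < size xi)%N -> x < last 0 xi ->
  bspline xi p i x != 0 -> xi`_i <= x < xi`_(i + p).+1.
Proof.
move=> + xlast; elim: p i => [|p IH] i ip.
  rewrite addn0 /=; case: (_ <= x < _) => //=.
  by rewrite (lt_eqF xlast) !andbF/= eqxx.
rewrite /= => Bx; have [B1|] := eqVneq (bspline xi p i x) 0; last first.
  move=> /IH -/(_ _)/andP[]; first by apply: leq_trans ip; rewrite addnS.
  move=> -> /=; move/lt_le_trans; apply; apply: knot_le.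
  by rewrite ip andbT addnS.
have [B2|] := eqVneq (bspline xi p i.+1 x) 0.
  by rewrite B1 B2 !mulr0 addr0 eqxx in Bx.
move=> /IH -/(_ _)/andP[]; first by rewrite addSnnS.
rewrite addSnnS => ix ->; rewrite andbT (le_trans _ ix)// knot_le//.
by rewrite leqnSn/= (leq_trans _ ip)// ltnS addnS ltnS leqW// leq_addr.
Qed.

(** Each weight of the recursion can be negative, but only where [bspline_support] makes the
    lower-degree B-spline it multiplies vanish. *)
Lemma bspline_ge0 p i x : ((i + p).+1 < size xi)%N -> x < last 0 xi ->
  0 <= bspline xi p i x.
Proof.
move=> + xlast; elim: p i => [|p IH] i ip; first by rewrite /= ler0n.
have ip1 : ((i + p).+1 < size xi)%N by apply: leq_trans ip; rewrite addnS.
have ip2 : ((i.+1 + p).+1 < size xi)%N by rewrite addSnnS.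
rewrite /= addr_ge0//.
  have [->|/(bspline_support ip1 xlast)/andP[ix xi1]] :=
    eqVneq (bspline xi p i x) 0; first by rewrite mulr0.
  rewrite mulr_ge0 ?IH// divr_ge0 ?subr_ge0// knot_le// addnS ip1 andbT.
  by rewrite leqW// leq_addr.
have [->|/(bspline_support ip2 xlast)/andP[ix xi1]] :=
  eqVneq (bspline xi p i.+1 x) 0; first by rewrite mulr0.
rewrite addSnnS in xi1.
rewrite mulr_ge0 ?IH// divr_ge0 ?subr_ge0//; first exact: ltW.
by rewrite knot_le// ip andbT addnS ltnS leqW// leq_addr.
Qed.

(** Knot spans are closed on the left, so the indicators of degree 0 are right-continuous even at
    repeated knots, and the recursion preserves this. It later yields a region of positive measure
    on which a B-spline stays positive. *)
Lemma bspline_right_continuous p i x : x < last 0 xi ->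
  bspline xi p i y @[y --> x^'+] --> bspline xi p i x.
Proof.
move=> xlast; elim: p i => [|p IH] i.
  apply: cvg_near_cst.
  (* Both [a <= x] and [x < a] persist immediately to the right of [x]. *)
  have knot_near (a : R) : \forall y \near x^'+, (a <= y) = (a <= x).
    have [ax|xa] := leP a x.
      near=> y; apply: (le_trans ax); apply/ltW; near: y.
      exact: nbhs_right_gt.
    near=> y; apply/negbTE; rewrite -ltNge; near: y; exact: nbhs_right_lt.
  near=> y => /=.
  have -> : (y == last 0 xi) = (x == last 0 xi).
    rewrite (lt_eqF xlast) lt_eqF//; near: y; exact: nbhs_right_lt.
  rewrite ![_ < xi`_i.+1]ltNge.
  have -> : (xi`_i <= y) = (xi`_i <= x) by near: y; exact: knot_near.
  by have -> : (xi`_i.+1 <= y) = (xi`_i.+1 <= x) by near: y; exact: knot_near.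
have xright : y @[y --> x^'+] --> x.
  by apply: cvg_at_right_filter; exact: cvg_id.
apply: cvgD; (apply: cvgM; last exact: IH); apply: cvgM.
- by apply: cvgB => //; exact: cvg_cst.
- exact: cvg_cst.
- by apply: cvgB => //; exact: cvg_cst.
- exact: cvg_cst.
Unshelve. all: by end_near.
Qed.

Lemma measurable_bspline p i : measurable_fun [set: R] (bspline xi p i).
Proof.
elim: p i => [|p IH] i.
  rewrite [X in measurable_fun _ X](_ : _ = fun x =>
    if (xi`_i <= x < xi`_i.+1) ||
       [&& xi`_i < xi`_i.+1, xi`_i.+1 == last 0 xi & x == last 0 xi]
    then 1 else 0); last by apply/funext => x /=; case: ifP.
  apply: measurable_fun_ifT => //; apply: measurable_or.
    by apply: measurable_and; [exact: measurable_fun_ler|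
      exact: measurable_fun_ltr].
  by apply: measurable_and => //; apply: measurable_and => //;
    exact: measurable_fun_eqr.
apply: measurable_funD;
  (apply: measurable_funM => //; apply: measurable_funM => //).
- exact: measurable_funB.
- exact: measurable_funB.
Qed.

Lemma bounded_measurable_bspline p i (a b : R) :
  bounded_measurable `]a, b[ (bspline xi p i).
Proof.
elim: p i => [|p IH] i.
  split; first exact: measurable_funTS (measurable_bspline 0 i).
  exists 1 => x _ /=; rewrite normr_nat.
  by case: (_ || _); rewrite ?lexx ?ler01.
by do ![exact: IH | exact: bounded_measurable_id_itv
  | exact: bounded_measurable_cst | apply: bounded_measurableN
  | apply: bounded_measurableD | apply: bounded_measurableM].
Qed.

(* The product rule applied to the Cox-de Boor recursion; it is the derivative
   of the B-spline away from the knots only. *)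
Fixpoint dbspline p i x : R :=
  match p with
  | 0 => 0
  | q.+1 =>
      (xi`_(i + p) - xi`_i)^-1 * bspline xi q i x +
      (x - xi`_i) / (xi`_(i + p) - xi`_i) * dbspline q i x +
      (- (xi`_(i + p).+1 - xi`_i.+1)^-1 * bspline xi q i.+1 x +
       (xi`_(i + p).+1 - x) / (xi`_(i + p).+1 - xi`_i.+1) *
         dbspline q i.+1 x)
  end.

(** Away from the knots the indicators of degree 0 are locally constant, and the product rule does
    the rest. The point 0 is excluded too, being the default value of a knot whose index falls
    outside the list. *)
Lemma is_derive_bspline p i x : x \notin 0 :: xi ->
  is_derive x 1 (bspline xi p i) (dbspline p i x).
Proof.
move=> xxi; have xk k : x != xi`_k.
  apply: contraNneq xxi => ->; have [ks|ks] := ltnP k (size xi).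
    by rewrite inE mem_nth ?orbT.
  by rewrite nth_default// mem_head.
elim: p i => [|p IH] i.
  apply: (@near_eq_is_derive _ _ _ (cst (bspline xi 0 i x))).
  have knot_near a : x != a -> \forall y \near x, (a <= y) = (a <= x).
    move=> xa; have [ax|{}xa] := leP a x.
      have {xa}ax : a < x by rewrite lt_def xa.
      near=> y; apply/ltW; near: y; exact: lt_nbhsr.
    near=> y; apply/negbTE; rewrite -ltNge; near: y; exact: lt_nbhsl.
  have xl : x != last 0 xi by apply: contraNneq xxi => ->; exact: mem_last.
  near=> y => /=.
  have -> : (y == last 0 xi) = (x == last 0 xi).
    rewrite (negbTE xl); apply/negbTE; near: y.
    by apply: open_nbhs_nbhs; split; [exact: open_neq|exact: xl].
  rewrite ![_ < xi`_i.+1]ltNge.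
  have -> : (xi`_i <= y) = (xi`_i <= x) by near: y; exact: knot_near.
  by have -> : (xi`_i.+1 <= y) = (xi`_i.+1 <= x) by near: y; exact: knot_near.
have dl (a c : R) : is_derive x 1 (fun y => (y - a) / c) c^-1.
  apply: (@is_derive_eq _ _ _ ((id - cst a) * cst c^-1)).
  by rewrite /GRing.scale/= !mulr0 add0r subr0 mulr1.
have dr (a c : R) : is_derive x 1 (fun y => (a - y) / c) (- c^-1).
  apply: (@is_derive_eq _ _ _ ((cst a - id) * cst c^-1)).
  by rewrite /GRing.scale/= !mulr0 add0r sub0r mulrN1.
have dM (f g : R -> R) df dg : is_derive x 1 f df -> is_derive x 1 g dg ->
    is_derive x 1 (fun y => f y * g y) (df * g x + f x * dg).
  move=> hf hg; apply: (@is_derive_eq _ _ _ (f * g)).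
  by rewrite /GRing.scale/= addrC [g x * _]mulrC.
exact: is_deriveD (dM _ _ _ _ (dl xi`_i (xi`_(i + p.+1) - xi`_i)) (IH i))
  (dM _ _ _ _ (dr xi`_(i + p.+1).+1 (xi`_(i + p.+1).+1 - xi`_i.+1))
    (IH i.+1)).
Unshelve. all: by end_near.
Qed.

Lemma derive_bspline_bounded_measurable p i (a b : R) :
  bounded_measurable `]a, b[ ('D_1 (bspline xi p i)).
Proof.
apply: (@bounded_measurable_eq_off_seq _ _ (0 :: xi) (dbspline p i)) => //.
  elim: p i => [|p IH] i; first exact: bounded_measurable_cst.
  by do ![exact: IH | exact: bounded_measurable_bspline
    | exact: bounded_measurable_id_itv | exact: bounded_measurable_cst
    | apply: bounded_measurableN | apply: bounded_measurableD
    | apply: bounded_measurableM].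
by move=> x /(is_derive_bspline p i) H; rewrite derive_val.
Qed.

(** A two-sided limit of difference quotients, if it exists, equals the right-hand one, which is 0
    here; if it does not exist, the derivative takes the default value 0. *)
Lemma derive_right_constant (f : R -> R) x :
  (\forall y \near x^'+, f y = f x) -> 'D_1 f x = 0.
Proof.
move=> fx; rewrite /derive.
set F := fun h : R => _.
have F0 : F h @[h --> 0^'+] --> (0 : R).
  apply: cvg_near_cst; rewrite /F.
  have : \forall h \near (0 : R)^'+, f (h + x) = f x.
    have [e /= e0 He] := fx; exists e => //= h /=.
    rewrite sub0r normrN => he h0; apply: He => /=; last by rewrite ltrDr.
    by rewrite opprD addrCA subrr addr0 normrN.
  by apply: filterS => h fh /=; rewrite [h *: 1]mulr1 fh subrr scaler0.
have [cF|ncF] := pselect (cvg (F h @[h --> 0^'])); last by rewrite dvgP.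
by rewrite cvg_at_rightE//; exact: cvg_lim.
Qed.

(** The first support ends no later than the knot [j] where the second begins. Left of that knot the
    second B-spline vanishes at [x] and just to its right; from that knot on the first one does. By
    [derive_right_constant] the derivative of the same factor vanishes as well, so the products are
    0 even at the knots. *)
Lemma derive_bspline_separated p i j x :
  (i + p < j)%N -> ((j + p).+1 < size xi)%N -> x < last 0 xi ->
  bspline xi p i x * bspline xi p j x = 0 /\
  'D_1 (bspline xi p i) x * 'D_1 (bspline xi p j) x = 0.
Proof.
move=> ij jsz xlast.
have isz : ((i + p).+1 < size xi)%N.
  by apply: leq_trans jsz; rewrite !ltnS; lia.
have kle : xi`_(i + p).+1 <= xi`_j by apply: knot_le; lia.
have near_last : \forall y \near x^'+, y < last 0 xi by exact: nbhs_right_lt.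
have vanish k : ((k + p).+1 < size xi)%N ->
    (\forall y \near x^'+, ~~ (xi`_k <= y < xi`_(k + p).+1)) ->
    ~~ (xi`_k <= x < xi`_(k + p).+1) ->
    bspline xi p k x = 0 /\ 'D_1 (bspline xi p k) x = 0.
  move=> ksz kn kx.
  have Bx : bspline xi p k x = 0.
    by apply: contraNeq kx; exact: bspline_support.
  split=> //; apply: derive_right_constant; rewrite Bx.
  near=> y; apply: contraTeq isT => /bspline_support; rewrite ksz.
  have yl : y < last 0 xi by near: y.
  have yk : ~~ (xi`_k <= y < xi`_(k + p).+1) by near: y.
  by move=> /(_ isT yl); rewrite (negbTE yk).
have [xj|jx] := ltP x xi`_j.
  have [-> ->] : bspline xi p j x = 0 /\ 'D_1 (bspline xi p j) x = 0.
    apply: vanish => //; last by rewrite leNgt xj.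
    near=> y; rewrite leNgt; have -> // : y < xi`_j.
    by near: y; exact: nbhs_right_lt.
  by rewrite !mulr0.
have [-> ->] : bspline xi p i x = 0 /\ 'D_1 (bspline xi p i) x = 0.
  apply: vanish => //; last by rewrite [x < _]ltNge (le_trans kle jx) andbF.
  near=> y; rewrite ltNge negb_and negbK; apply/orP; right.
  by apply: (le_trans (le_trans kle jx)); near: y; exact: nbhs_right_ge.
by rewrite !mul0r.
Unshelve. all: by end_near.
Qed.

End bspline_theory.

(** * Partial derivatives and Lebesgue measure on R^d *)

(** For nonzero [c] the two limits exist simultaneously, and otherwise both sides are the default 0.
    This lets the constant factors of a tensor product leave a difference quotient. *)
Lemma lim_mull {R : realType} (T : Type) (F : set_system T)
    {FF : ProperFilter F} (c : R) (f : T -> R) :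
  lim (c * f x @[x --> F]) = c * lim (f x @[x --> F]).
Proof.
have [->|c0] := eqVneq c 0.
  rewrite mul0r; apply: cvg_lim => //.
  by under eq_fun do rewrite mul0r; exact: cvg_cst.
have [cf|ncf] := pselect (cvg (f x @[x --> F])).
  by apply: cvg_lim => //; apply: cvgM => //; exact: cvg_cst.
rewrite (dvgP ncf) dvgP ?mulr0// => ccf; apply: ncf.
have -> : f = fun x => c^-1 * (c * f x).
  by apply/funext => x; rewrite mulKf.
by apply: is_cvgM => //; exact: is_cvg_cst.
Qed.

Section euclidean_theory.
Context {R : realType} {d : nat}.

(* No differentiability is needed: limits that do not exist are 0. *)
Lemma partial_prod (l : 'I_d) (F : 'I_d -> R -> R) (x : 'rV[R]_d) :
  partial l (fun y => \prod_(k < d) F k (y 0 k)) x =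
  'D_1 (F l) (x 0 l) * \prod_(k < d | k != l) F k (x 0 k).
Proof.
rewrite /partial /derive mulrC -lim_mull.
set f := (X in lim (X @ _)); set g := (X in _ = lim (X @ _)).
suff -> : f = g by []; apply/funext => h; rewrite /f /g /=.
rewrite (bigD1 l)//= [X in _ - X](bigD1 l)//= [h *: 1]mulr1 !mxE !eqxx mulr1.
rewrite (eq_bigr (fun k => F k (x 0 k))); last first.
  by move=> k /negPf kl; rewrite !mxE kl andbF mulr0 add0r.
by rewrite -mulrBl [RHS]mulrC -[RHS]mulrA; congr (_ * _).
Qed.

Lemma measurable_tuple_box (A : 'I_d -> set (measurableTypeR R)) :
  (forall i, measurable (A i)) ->
  measurable [set t : d.-tuple (measurableTypeR R) | forall i, A i (tnth t i)].
Proof.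
move=> mA; rewrite [X in measurable X](_ : _ =
  \big[setI/setT]_(i < d) ((@tnth d (measurableTypeR R))^~ i @^-1` A i)).
  apply: bigsetI_measurable => i _; rewrite -[X in measurable X]setTI.
  exact: measurable_tnth.
rewrite -bigcap_seq; apply/seteqP; split => t /= H i; first by move=> _.
by apply: H => /=; rewrite mem_index_enum.
Qed.

(** The sigma-algebra on tuples is generated by the coordinates, so open sets have to be reached
    through boxes: an open set is the countable union of the boxes with rational endpoints that it
    contains. *)
Lemma measurable_preimage_open (D : set 'rV[R]_d) : open D ->
  measurable (@row_of_tuple R d @^-1` D).
Proof.
move=> oD.
pose box (q : {ffun 'I_d -> rat * rat}) :=
  [set t : d.-tuple (measurableTypeR R) |
    forall i, [set` `]ratr (q i).1, ratr (q i).2[%R] (tnth t i)].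
pose F q := if `[< box q `<=` @row_of_tuple R d @^-1` D >] then box q else set0.
have -> : @row_of_tuple R d @^-1` D = \bigcup_q F q.
  apply/seteqP; split => t /=; last first.
    by move=> [q _]; rewrite /F; case: asboolP => // + tq; exact.
  move=> Dt; have /nbhs_ballP[e /= e0 eD] : nbhs (row_of_tuple t) D.
    by apply: open_nbhs_nbhs; split.
  (* Rational endpoints within [e] on both sides of each coordinate give a box around the point
     inside its sup-norm ball of radius [e]. *)
  have /choice[q qP] i : exists q : rat * rat,
      tnth t i - e < ratr q.1 < tnth t i /\ tnth t i < ratr q.2 < tnth t i + e.
    have [|a] := @rat_in_itvoo _ (tnth t i - e) (tnth t i).
      by rewrite ltrBlDr ltrDl.
    have [|b] := @rat_in_itvoo _ (tnth t i) (tnth t i + e).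
      by rewrite ltrDl.
    by rewrite !in_itv/= => ? ?; exists (a, b).
  exists [ffun i => q i] => //; rewrite /F; case: asboolP => [_ i|[]].
    by rewrite /= ffunE in_itv/=; have [/andP[_ ->] /andP[-> _]] := qP i.
  move=> s /= sq; apply: eD; split=> // i j; rewrite (ord1 i) !mxE /ball/=.
  have := sq j; rewrite /= ffunE in_itv/= => /andP[qs sq'].
  have [/andP[? ?] /andP[? ?]] := qP j.
  by rewrite ltr_norml; apply/andP; split; lra.
apply: countable_bigcupT_measurable => [|q]; first exact: countableP.
rewrite /F; case: asboolP => _; last exact: measurable0.
apply: (@measurable_tuple_box
  (fun i => [set` `]ratr (q i).1, ratr (q i).2[%R])) => i.
exact: measurable_itv.
Qed.

Lemma lebesgue_tuple_itv (a b : 'I_d -> R) : (forall l, a l < b l) ->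
  lebesgue_tuple R d [set t | forall l, [set` `]a l, b l[%R] (tnth t l)] =
  (\prod_(l < d) (b l - a l))%:E.
Proof.
move=> ab; rewrite (@lebesgue_tuple_box R d (fun l => [set` `]a l, b l[%R])).
  rewrite -prodEFin; apply: eq_bigr => l _.
  by rewrite lebesgue_measure_itv/= lte_fin ab EFinB.
by move=> l; exact: measurable_itv.
Qed.

End euclidean_theory.

(** * Stiffness and lumped mass matrices *)

Section discretization_theory.
Context {R : realType} {d : nat} {p : 'I_d -> nat}.
Variable X : trimmed_discretization R p.
Implicit Types (i j : multi_index X) (k l : 'I_d).

Let domain_tuples : set (d.-tuple (measurableTypeR R)) :=
  @row_of_tuple R d @^-1` domain X.

Let knot_interval l : set R :=
  [set` `]head 0 (knots X l), last 0 (knots X l)[%R].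

Lemma knots_sorted l : sorted <=%R (knots X l).
Proof. by have [] := open_knots X l. Qed.

Lemma multi_index_bound i l : ((i l + p l).+1 < size (knots X l))%N.
Proof. by have := ltn_ord (i l); rewrite /bspline_number; lia. Qed.

Lemma domain_knot_interval x l : domain X x -> knot_interval l (x 0 l).
Proof.
by move=> /(@domain_sub_box _ _ _ X)/(_ l); rewrite /knot_interval/= in_itv.
Qed.

(** The domain lies in the open knot box, so the right-closed convention of the last knot span never
    interferes on it. *)
Lemma domain_lt_last x l : domain X x -> x 0 l < last 0 (knots X l).
Proof.
move=> /domain_knot_interval-/(_ l).
by rewrite /knot_interval/= in_itv/= => /andP[].
Qed.

Lemma measurable_domain_tuples : measurable domain_tuples.
Proof. exact: measurable_preimage_open (@open_domain _ _ _ X). Qed.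

Lemma domain_tuples_finite : (lebesgue_tuple R d domain_tuples < +oo)%E.
Proof.
have mbox := @measurable_tuple_box R d knot_interval
  (fun l => measurable_itv _).
apply: (@le_lt_trans _ _ (lebesgue_tuple R d
    [set t | forall l, knot_interval l (tnth t l)])).
  apply: le_measure; rewrite ?inE//; first exact: measurable_domain_tuples.
  by move=> t /domain_knot_interval tD l; have := tD l; rewrite mxE.
rewrite lebesgue_tuple_itv ?ltry// => l.
by have [] := open_knots X l.
Qed.

Lemma tensor_bspline_bounded_measurable i :
  bounded_measurable domain_tuples
    (fun t => tensor_bspline i (row_of_tuple t)).
Proof.
apply: bounded_measurable_prod => l _; under eq_fun do rewrite mxE.
apply: (bounded_measurable_comp (E := knot_interval l)).
- exact: measurable_itv.
- by move=> t /domain_knot_interval-/(_ l); rewrite mxE.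
- exact: measurable_funTS (measurable_tnth _).
- exact: bounded_measurable_bspline.
Qed.

Lemma partial_tensor_bspline i l x : partial l (tensor_bspline i) x =
  'D_1 (bspline (knots X l) (p l) (i l)) (x 0 l) *
  \prod_(k < d | k != l) bspline (knots X k) (p k) (i k) (x 0 k).
Proof.
exact: (partial_prod l (fun k => bspline (knots X k) (p k) (i k))).
Qed.

Lemma partial_tensor_bspline_bounded_measurable i l :
  bounded_measurable domain_tuples
    (fun t => partial l (tensor_bspline i) (row_of_tuple t)).
Proof.
under eq_fun do rewrite partial_tensor_bspline mxE.
have tnthE k (f : R -> R) :
    bounded_measurable (knot_interval k) f ->
    bounded_measurable domain_tuples (fun t => f (tnth t k)).
  apply: bounded_measurable_comp.
  - exact: measurable_itv.
  - by move=> t /domain_knot_interval-/(_ k); rewrite mxE.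
  - exact: measurable_funTS (measurable_tnth _).
apply: bounded_measurableM.
  exact: (tnthE l _ (derive_bspline_bounded_measurable _ _ _ _ _)).
apply: bounded_measurable_prod => k _; under eq_fun do rewrite mxE.
exact: (tnthE k _ (bounded_measurable_bspline _ _ _ _ _)).
Qed.

(** This is the integral of the squared norm of [s] times the first gradient minus [t] times the
    second, which is nonnegative pointwise. Bounded measurability supplies the integrability
    required to split the integral. *)
Lemma dirichlet_form_amgm i j (s t : R) :
  2 * (s * t) * dirichlet_form (domain X) (tensor_bspline i) (tensor_bspline j)
  <= s ^+ 2 * dirichlet_form (domain X) (tensor_bspline i) (tensor_bspline i)
   + t ^+ 2 * dirichlet_form (domain X) (tensor_bspline j) (tensor_bspline j).
Proof.
have bm i' j' : bounded_measurable domain_tuples (fun z =>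
    \sum_(l < d) partial l (tensor_bspline i') (row_of_tuple z) *
                 partial l (tensor_bspline j') (row_of_tuple z)).
  apply: bounded_measurable_sum => l _; apply: bounded_measurableM;
  exact: partial_tensor_bspline_bounded_measurable.
have int f : bounded_measurable domain_tuples f ->
    (lebesgue_tuple R d).-integrable domain_tuples (EFin \o f).
  apply: bounded_measurable_integrable.
    exact: measurable_domain_tuples.
  exact: domain_tuples_finite.
have mD := measurable_domain_tuples.
rewrite /dirichlet_form /integral_over -!RintegralZl//; try exact: int (bm _ _).
rewrite -RintegralD//; last 2 first.
- by apply: int; apply: bounded_measurableM; [exact: bounded_measurable_cst|].
- by apply: int; apply: bounded_measurableM; [exact: bounded_measurable_cst|].
apply: le_Rintegral => //.
- by apply: int; apply: bounded_measurableM; [exact: bounded_measurable_cst|].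
- by apply: int; apply: bounded_measurableD; apply: bounded_measurableM => //;
    exact: bounded_measurable_cst.
move=> z _; rewrite !mulr_sumr -big_split/=; apply: ler_sum => l _.
set a := partial _ _ _; set b := partial _ _ _.
have := sqr_ge0 (s * a - t * b); rewrite -subr_ge0.
by congr (is_true (0 <= _)); ring.
Qed.

Lemma dirichlet_form_sym (u v : 'rV[R]_d -> R) :
  dirichlet_form (domain X) u v = dirichlet_form (domain X) v u.
Proof.
congr (integral_over _ _); apply/funext => x.
by apply: eq_bigr => l _; rewrite mulrC.
Qed.

Lemma dirichlet_form_ge0 (u : 'rV[R]_d -> R) :
  0 <= dirichlet_form (domain X) u u.
Proof.
by apply: Rintegral_ge0 => t _; apply: sumr_ge0 => l _; rewrite -expr2 sqr_ge0.
Qed.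

(** * Overlapping indices and sparsity of the Dirichlet form *)

(** In each direction the indices differ by at most the degree. Comparing indices rather than
    supports makes the neighbour count purely combinatorial, and additions avoid truncated
    subtraction. *)
Definition overlap : rel (multi_index X) := fun i j =>
  [forall l, (i l <= j l + p l)%N && (j l <= i l + p l)%N].

Lemma overlap_sym : symmetric overlap.
Proof. by move=> i j; apply: eq_forallb => l; rewrite andbC. Qed.

(** Relative to [i], a neighbour is determined by its offset in each direction, which ranges over
    the [2 * p l + 1] integers from [- p l] to [p l]. *)
Lemma card_overlap i : (#|overlap i| <= \prod_(l < d) (2 * p l + 1))%N.
Proof.
pose T := {dffun forall l, 'I_(2 * p l + 1)}.
(* Adding [p l] makes the offsets natural numbers. The cap by [minn] only serves to define the map
   on all indices; on neighbours neither it nor the truncated subtraction has any effect. *)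
have shift_lt j l : (minn (j l + p l - i l) (2 * p l) < 2 * p l + 1)%N.
  by rewrite addn1 ltnS geq_minr.
pose shift j : T := [ffun l => Ordinal (shift_lt j l)].
have shift_inj : {in overlap i &, injective shift}.
  move=> j j' /forallP ij /forallP ij' /ffunP jj'; apply/ffunP => l.
  have := congr1 val (jj' l); rewrite !ffunE /= => E.
  apply: val_inj; move: (ij l) (ij' l) E => /=.
  by move: (p l) (i l : nat) (j l : nat) (j' l : nat) => q a b b'; lia.
rewrite -(card_in_imset shift_inj) (leq_trans (max_card _))//.
rewrite card_dep_ffun foldrE big_map big_enum/=.
by apply: leq_prod => l _; rewrite card_ord.
Qed.

(** One direction [l] in which the indices are far apart suffices: each partial derivative product
    contains either both univariate derivatives or both univariate B-splines in direction [l], and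
    either product is 0. *)
Lemma dirichlet_form_separated i j : ~~ overlap i j ->
  dirichlet_form (domain X) (tensor_bspline i) (tensor_bspline j) = 0.
Proof.
wlog [l ij] : i j / exists l, (i l + p l < j l)%N.
  move=> wl nij; have := nij; rewrite negb_forall => /existsP[l].
  rewrite negb_and -!ltnNge => /orP[ji|ij]; last by apply: wl => //; exists l.
  by rewrite dirichlet_form_sym; apply: wl; [exists l|rewrite overlap_sym].
move=> _; rewrite /dirichlet_form /integral_over.
transitivity (\int[lebesgue_tuple R d]_(t in domain_tuples) (0 : R)).
  apply: eq_Rintegral => t; rewrite inE => tD.
  apply: big1 => k _.
  rewrite !partial_tensor_bspline.
  have [B0 dB0] := derive_bspline_separated (knots_sorted l) ij
    (multi_index_bound j l) (domain_lt_last l tD).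
  have [->|kl] := eqVneq k l; first by rewrite mulrACA dB0 mul0r.
  by rewrite mulrACA -big_split/= (bigD1 l) 1?eq_sym//= B0 mul0r mulr0.
by rewrite Rintegral_cst ?mul0r//; exact: measurable_domain_tuples.
Qed.

(** * Positivity of the lumped masses *)

Lemma tensor_bspline_ge0 i x : domain X x -> 0 <= tensor_bspline i x.
Proof.
move=> Dx; apply: prodr_ge0 => l _; apply: bspline_ge0.
- exact: knots_sorted.
- exact: multi_index_bound.
- exact: domain_lt_last.
Qed.

(** The B-spline is nonzero at some point of the domain, and right continuity spreads this to a
    small cube with that point as lower corner, on which the square has a positive lower bound. *)
Lemma integral_tensor_bspline_sqr_gt0 i : i \in trimmed_basis X ->
  0 < integral_over (domain X)
        (fun x => tensor_bspline i x * tensor_bspline i x).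
Proof.
rewrite inE => /asboolP[y [yS yD]].
(* The support is a closure, so the open domain that meets it also meets the set where the B-spline
   is nonzero. *)
have [x [/= xi xD]] := yS _ (open_nbhs_nbhs (conj (@open_domain _ _ _ X) yD)).
pose B l := bspline (knots X l) (p l) (i l).
have Bx l : 0 < B l (x 0 l).
  rewrite lt_def bspline_ge0 ?andbT//; last 3 first.
  - exact: knots_sorted.
  - exact: multi_index_bound.
  - exact: domain_lt_last.
  apply: contraNneq xi => Bl0.
  by rewrite /tensor_bspline (bigD1 l)//= [bspline _ _ _ _]Bl0 mul0r.
have near1 l : \forall e \near (0 : R)^'+, forall z, x 0 l < z < x 0 l + e ->
    B l (x 0 l) / 2 < B l z.
  have : \forall z \near (x 0 l)^'+, B l (x 0 l) / 2 < B l z.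
    have := @bspline_right_continuous _ _ (p l) (i l) _ (domain_lt_last l xD).
    by move/cvgr_gt; apply; have := Bx l; rewrite /B; lra.
  move=> [r /= r0 Hr]; near=> e => z /andP[xz ze]; apply: Hr => //=.
  rewrite distrC gtr0_norm ?subr_gt0// ltrBlDl (lt_trans ze)// ltrD2l.
  by near: e; exact: nbhs_right_lt.
have near2 : \forall e \near (0 : R)^'+, (ball x e `<=` domain X).
  exact: open_subball (@open_domain _ _ _ X) xD.
have : \forall e \near (0 : R)^'+, [/\ 0 < e, (ball x e `<=` domain X) &
    forall l z, x 0 l < z < x 0 l + e -> B l (x 0 l) / 2 < B l z].
  have near3 : \forall e \near (0 : R)^'+, forall l z,
      x 0 l < z < x 0 l + e -> B l (x 0 l) / 2 < B l z.
    exact: filter_forall.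
  by near=> e; split; [|near: e|near: e].
move=> /filter_ex[e [e0 eD eB]].
pose A l : set (measurableTypeR R) := [set` `]x 0 l, x 0 l + e[%R].
pose S := [set t : d.-tuple (measurableTypeR R) | forall l, A l (tnth t l)].
have mS : measurable S.
  by apply: measurable_tuple_box => l; exact: measurable_itv.
have SD : S `<=` domain_tuples.
  move=> t St; apply: eD; split => // u l; rewrite (ord1 u) mxE /ball/=.
  have := St l; rewrite /A/= in_itv/= => /andP[? ?].
  by rewrite ltr_norml; apply/andP; split; lra.
have muS : (lebesgue_tuple R d S = (e ^+ d)%:E)%E.
  rewrite lebesgue_tuple_itv => [|l]; last by rewrite ltrDl.
  under eq_bigr do rewrite addrAC subrr add0r.
  by rewrite prodr_const card_ord.
pose c := \prod_(l < d) (B l (x 0 l) / 2).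
have c0 : 0 < c by apply: prodr_gt0 => l _; rewrite divr_gt0.
have mD := measurable_domain_tuples.
have fD := domain_tuples_finite.
have bmS : bounded_measurable domain_tuples (\1_S : _ -> R).
  split; first by apply: measurable_funTS; exact: measurable_indic.
  by exists 1 => t _; rewrite indicE normr_nat; case: (_ \in _); rewrite ?ler01.
(* The comparison function is [c ^+ 2] on the cube [S] of side [e] and 0 elsewhere; [c] multiplies
   the halved values of the univariate factors at the corner. *)
have intS : \int[lebesgue_tuple R d]_(t in domain_tuples) (c ^+ 2 * \1_S t) =
    c ^+ 2 * e ^+ d.
  rewrite RintegralZl//; last exact: bounded_measurable_integrable.
  rewrite /Rintegral integral_indic// (setIidl SD).
  by congr (_ * _); exact: (congr1 fine muS).
apply: (@lt_le_trans _ _ (c ^+ 2 * e ^+ d)).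
  by rewrite mulr_gt0// exprn_gt0.
rewrite -intS; apply: le_Rintegral => //.
- apply: bounded_measurable_integrable => //.
  by apply: bounded_measurableM => //; exact: bounded_measurable_cst.
- apply: bounded_measurable_integrable => //.
  by apply: bounded_measurableM; exact: tensor_bspline_bounded_measurable.
move=> t tD; rewrite indicE -expr2; have [|tS] := boolP (t \in S); last first.
  by rewrite mulr0 sqr_ge0.
rewrite inE => tS; rewrite mulr1 ler_sqr ?nnegrE ?(ltW c0)//; last first.
  exact: tensor_bspline_ge0.
apply: ler_prod => l _; rewrite divr_ge0 ?(ltW (Bx l))//= mxE ltW// eB//.
by have := tS l; rewrite /A/= in_itv.
Unshelve. all: by end_near.
Qed.

Lemma active_basis_trimmed (a : 'I_#|active_basis X|) :
  enum_val a \in trimmed_basis X.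
Proof. by have := enum_valP a; rewrite inE => /andP[]. Qed.

(** Every term of the row sum is nonnegative, and the sum over [trimmed_basis] includes the diagonal
    term, the integral of a square that is positive. *)
Lemma lumped_mass_gt0 (a : 'I_#|active_basis X|) : 0 < lumped_mass X a a.
Proof.
rewrite !mxE eqxx mulr1n (bigD1 _ (active_basis_trimmed a))/=.
rewrite ltr_pwDl//.
  exact: (integral_tensor_bspline_sqr_gt0 (active_basis_trimmed a)).
apply: sumr_ge0 => j _; apply: Rintegral_ge0 => t tD.
by rewrite mulr_ge0 ?tensor_bspline_ge0.
Qed.

End discretization_theory.

(** * Two-sided bound on the largest generalized eigenvalue *)

Theorem lemma3p1 (R : realType) :
  exists c : forall d : nat, ('I_d -> nat) -> R,
    (forall (d : nat) (p : 'I_d -> nat),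
       c d p <= \prod_(k < d) (2 * p k + 1)%:R) /\
    (forall (d : nat) (p : 'I_d -> nat) (X : trimmed_discretization R p),
       (0 < #|active_basis X|)%N ->
       exists2 lam : R,
         largest_gen_eigenvalue (stiffness X) (lumped_mass X) lam &
         max_diag_ratio (stiffness X) (lumped_mass X) <= lam
           <= c d p * max_diag_ratio (stiffness X) (lumped_mass X)).
Proof.
(* The constant is the product itself, so its required bound holds with equality. *)
exists (fun d p => \prod_(k < d) (2 * p k + 1)%:R); split=> // d p X n0.
set n := #|_| in n0; set K := stiffness X; set M := lumped_mass X.
have M0 : forall a, 0 < M a a by exact: lumped_mass_gt0.
pose m : 'rV[R]_n := \row_a M a a.
have ME : M = diag_mx m.
  apply/matrixP => a b; rewrite [RHS]mxE mxE; case: eqVneq => [->|_] //.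
  by rewrite !mulr1n !mxE eqxx mulr1n.
have Ksym : K^T = K.
  by apply/matrixP => a b; rewrite !mxE dirichlet_form_sym.
have K0 a : 0 <= K a a by rewrite mxE dirichlet_form_ge0.
have m0 a : 0 < m 0 a by rewrite mxE.
have [lam lamP lam_ray] := largest_gen_eigenvalue_diag n0 Ksym m0.
rewrite -ME in lamP lam_ray.
have lam_diag a : K a a / M a a <= lam.
  have := lam_ray (delta_mx 0 a); rewrite !quadratic_form_delta.
  by rewrite ler_pdivrMr.
have ratio_max a : K a a / M a a <= max_diag_ratio K M.
  exact: (le_bigmax_cond _ (fun a => K a a / M a a)).
exists lam => //; apply/andP; split.
  (* Since the maximum starts from 0, [lam] must also be shown nonnegative; it dominates the
     nonnegative ratio at the first index, which exists by [n0]. *)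
  apply/bigmax_leP; split=> //.
  apply: le_trans (lam_diag (Ordinal n0)).
  by rewrite divr_ge0// ltW.
have [[x x0 Kx] _] := lamP.
pose y := x^T.
have yM : 0 < quadratic_form M y.
  rewrite ME quadratic_form_diag_gt0//.
  by rewrite -(inj_eq (@trmx_inj _ _ _)) trmxK trmx0.
have Ky : quadratic_form K y = lam * quadratic_form M y.
  by rewrite !quadratic_formE trmxK -!mulmxA Kx -scalemxAr [LHS]mxE.
(* At an eigenvector the Rayleigh quotient equals [lam], so the upper bound reduces to an inequality
   between the two quadratic forms at [y]. *)
rewrite -(ler_pM2r yM) -Ky.
have := @quadratic_form_le_diag _ _ K
  (fun a b => overlap (enum_val a) (enum_val b))
  (\prod_(k < d) (2 * p k + 1)) y.
move=> /(_ _ _ _ _ _)/le_trans; apply.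
- by move=> a b s t; rewrite !mxE; exact: dirichlet_form_amgm.
- by move=> a b; rewrite !mxE; exact: dirichlet_form_separated.
- by move=> a b; exact: overlap_sym.
(* Enumeration of the active basis is injective, so active neighbours number at most all overlapping
   multi-indices. *)
- move=> a; apply: leq_trans (card_overlap (enum_val a)).
  rewrite -(card_imset _ (@enum_val_inj _ (active_basis X))).
  apply: subset_leq_card; apply/fintype.subsetP => j /imsetP[b].
  by rewrite inE => ? ->.
- by [].
rewrite natr_prod -mulrA ler_wpM2l// ?prodr_ge0//.
rewrite ME quadratic_form_diag mulr_sumr; apply: ler_sum => a _.
rewrite [leRHS]mulrA ler_wpM2r ?sqr_ge0// -ler_pdivrMr//.
by rewrite -ME [m 0 a]mxE ratio_max.
Qed.
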